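(* Suppose that $f$ is a double function which is defined at $a\in\mathbb{R}^2$. If $f$ is double differentiable at $a$, then $f$ is double continuous at $a$.
   Context: Points of $\mathbb{R}^2$ are written $a=(a_1,a_2)$; $a\nsim x$ means $a_1\ne x_1$ and $a_2\ne x_2$. A double function is a real-valued function $f$ with domain $D(f)\subseteq\mathbb{R}^2$. A double open interval is a product $I=I_1\times I_2$ of two open intervals in $\mathbb{R}$. The double difference is $\Delta_a^x(f)=f(x_1,x_2)-f(x_1,a_2)-f(a_1,x_2)+f(a_1,a_2)$, and for $a\nsim x$, $m_a^x(f)=\Delta_a^x(f)/((x_1-a_1)(x_2-a_2))$. $f$ is double differentiable at $a$ if $D(f)$ contains a double open interval containing $a$ and there is a real number $f'(a)$ such that for every $\epsilon>0$ there are $\delta_1,\delta_2>0$ such that for all $x$ with $0<|x_1-a_1|<\delta_1$ and $0<|x_2-a_2|<\delta_2$, $m_a^x(f)$ is defined and $|m_a^x(f)-f'(a)|<\epsilon$. $f$ is double continuous at $a$ if there is a double open interval $I=I_1\times I_2$ with $a\in I\subseteq D(f)$ such that for all $x_1\in I_1$, $\lim_{x_2\to a_2}\Delta_a^{(x_1,x_2)}(f)=0$, and for all $x_2\in I_2$, $\lim_{x_1\to a_1}\Delta_a^{(x_1,x_2)}(f)=0$. *)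

(* Defs.v *)
From HB Require Import structures.
From mathcomp Require Import all_boot all_order all_algebra.
From mathcomp Require Import all_classical all_reals all_analysis.

Set Implicit Arguments.
Unset Strict Implicit.
Unset Printing Implicit Defensive.

Import Order.TTheory GRing.Theory Num.Theory.
Import numFieldNormedType.Exports.

Local Open Scope classical_set_scope.
Local Open Scope ring_scope.

(* A partial function on R^2: [dfun] is totalized, and its values outside
   [ddom] carry no meaning; every notion below that evaluates it also requires
   the relevant points to lie in [ddom]. *)
Record double_function (R : realType) := DoubleFunction {
  ddom : set (R * R);
  dfun :> R * R -> R
}.

Definition nsim (R : realType) (a x : R * R) : Prop :=
  a.1 <> x.1 /\ a.2 <> x.2.

(* The endpoints range over the extended reals, so that open half-lines and the
   whole line are included. *)
Definition open_interval (R : realType) (I : set R) : Prop :=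
  exists l u : \bar R, I = [set x : R | (l < x%:E)%E /\ (x%:E < u)%E].

Definition double_open_interval (R : realType) (I1 I2 : set R) : Prop :=
  open_interval I1 /\ open_interval I2.

Definition double_diff (R : realType) (f : double_function R) (a x : R * R) : R :=
  f (x.1, x.2) - f (x.1, a.2) - f (a.1, x.2) + f (a.1, a.2).

Definition double_diff_defined (R : realType) (f : double_function R)
    (a x : R * R) : Prop :=
  [/\ ddom f (x.1, x.2), ddom f (x.1, a.2), ddom f (a.1, x.2)
    & ddom f (a.1, a.2)].

Definition double_slope (R : realType) (f : double_function R) (a x : R * R) : R :=
  double_diff f a x / ((x.1 - a.1) * (x.2 - a.2)).

Definition double_slope_defined (R : realType) (f : double_function R)
    (a x : R * R) : Prop :=
  nsim a x /\ double_diff_defined f a x.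

Definition is_double_derivative (R : realType) (f : double_function R)
    (a : R * R) (l : R) : Prop :=
  forall eps : R, 0 < eps ->
    exists d1 d2 : R, [/\ 0 < d1, 0 < d2 &
      forall x : R * R,
        0 < `|x.1 - a.1| < d1 -> 0 < `|x.2 - a.2| < d2 ->
        double_slope_defined f a x /\ `|double_slope f a x - l| < eps].

Definition double_differentiable (R : realType) (f : double_function R)
    (a : R * R) : Prop :=
  (exists I1 I2 : set R,
     [/\ double_open_interval I1 I2, (I1 `*` I2) a & I1 `*` I2 `<=` ddom f]) /\
  (exists l : R, is_double_derivative f a l).

(* Near the limit point all corners lie in I1 x I2, so the double difference is
   defined there. *)
Definition double_continuous (R : realType) (f : double_function R)
    (a : R * R) : Prop :=
  exists I1 I2 : set R,
    [/\ double_open_interval I1 I2, (I1 `*` I2) a, I1 `*` I2 `<=` ddom f,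
        (forall x1 : R, I1 x1 ->
           double_diff f a (x1, x2) @[x2 --> (a.2)^'] --> (0 : R))
      & (forall x2 : R, I2 x2 ->
           double_diff f a (x1, x2) @[x1 --> (a.1)^'] --> (0 : R))].

(* Main.v *)
Require Import Defs.
From mathcomp Require Import all_boot all_order all_algebra.
From mathcomp Require Import all_classical all_reals all_analysis.
From mathcomp Require Import ring.

Import Order.TTheory GRing.Theory Num.Theory.
Import numFieldNormedType.Exports.

Local Open Scope classical_set_scope.
Local Open Scope ring_scope.

(** If [l] is the double derivative, then near [a] the double difference is at
    most [(`|l| + 1) * `|x1 - a1| * `|x2 - a2|]; this bound persists when [x1 = a1]
    or [x2 = a2], where the double difference vanishes.  With one coordinate fixed
    it tends to 0 linearly in the other. *)

Lemma open_intervalI_ball (R : realType) (I : set R) (c d : R) :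
  open_interval I -> open_interval (I `&` [set x | `|x - c| < d]).
Proof.
move=> [l [u ->]].
exists (Order.max l (c - d)%:E), (Order.min u (c + d)%:E).
apply/seteqP; split=> x /=; rewrite gt_max lt_min !lte_fin ltr_distl.
  by move=> [[-> ->] /andP[-> ->]].
by move=> [/andP[-> ->] /andP[-> ->]].
Qed.

Lemma double_diff_bound (R : realType) (f : double_function R) (a : R * R)
    (l : R) :
  is_double_derivative f a l ->
  exists d1 d2 : R, [/\ 0 < d1, 0 < d2 &
    forall x : R * R, `|x.1 - a.1| < d1 -> `|x.2 - a.2| < d2 ->
      `|double_diff f a x| <= (`|l| + 1) * (`|x.1 - a.1| * `|x.2 - a.2|)].
Proof.
(* Any fixed tolerance would do; taking 1 bounds the slope by [|l| + 1] near [a]. *)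
move=> /(_ 1 ltr01) [d1 [d2 [d1_gt0 d2_gt0 slopeP]]].
exists d1, d2; split=> // x x1d x2d.
(* [slopeP] is silent on the two lines through [a], where the terms of the double difference cancel
   in pairs. *)
have [x1E|x1N] := eqVneq x.1 a.1.
  have -> : double_diff f a x = 0 by rewrite /double_diff x1E; ring.
  by rewrite normr0 !mulr_ge0 ?addr_ge0.
have [x2E|x2N] := eqVneq x.2 a.2.
  have -> : double_diff f a x = 0 by rewrite /double_diff x2E; ring.
  by rewrite normr0 !mulr_ge0 ?addr_ge0.
have [||_ slope_lt] := slopeP x; rewrite ?normr_gt0 ?subr_eq0 ?x1N ?x2N //.
have prodN : (x.1 - a.1) * (x.2 - a.2) != 0.
  by rewrite mulf_neq0 ?subr_eq0.
rewrite -[double_diff f a x](divfK prodN) normrM -[in leRHS]normrM.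
apply: ler_wpM2r => //; rewrite -/(double_slope f a x).
rewrite -[double_slope f a x](subrK l) (le_trans (ler_normD _ _)) //.
by rewrite addrC lerD2l ltW.
Qed.

Lemma cvg_dnbhs_linear_bound (R : realType) (g : R -> R) (c d K : R) :
  0 < d -> (forall t, `|t - c| < d -> `|g t| <= K * `|t - c|) ->
  g t @[t --> c^'] --> (0 : R).
Proof.
(* The bound covers [t = c] too, so the limit is taken over full neighbourhoods and then restricted
   to punctured ones. *)
move=> d_gt0 gK; apply: cvg_within_filter.
apply: norm_cvg0.
have lim0 : K * `|t - c| @[t --> c] --> (0 : R).
  have <- : K * `|c - c| = 0 by rewrite subrr normr0 mulr0.
  apply: (cvgM (cvg_cst K)); apply: cvg_norm.
  exact: cvgB cvg_id (cvg_cst c).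
apply: (squeeze_cvgr _ (cvg_cst 0) lim0).
apply: filterS (nbhsx_ballx c d d_gt0) => t ct.
by rewrite normr_ge0 gK // distrC.
Qed.

Theorem proposition14 (R : realType) (f : double_function R) (a : R * R) :
  ddom f a -> double_differentiable f a -> double_continuous f a.
Proof.
move=> _ [[I1 [I2 [[I1o I2o] [I1a I2a] I12f]]] [l]].
move=> /double_diff_bound [d1 [d2 [d1_gt0 d2_gt0 bound]]].
(* Double continuity asks for a limit at every fixed coordinate in the chosen intervals, so these
   are cut down to where [bound] applies. *)
exists (I1 `&` [set x | `|x - a.1| < d1]), (I2 `&` [set x | `|x - a.2| < d2]).
split.
- by split; exact: open_intervalI_ball.
- by split; split=> //=; rewrite subrr normr0.
- by move=> x [[I1x _] [I2x _]]; exact: I12f.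
- move=> x1 [_ /= x1d].
  (* The fixed factor [|x1 - a.1|] is absorbed into the constant, leaving a bound linear in [t]'s
     distance to [a.2]. *)
  apply: (@cvg_dnbhs_linear_bound _ _ _ _ ((`|l| + 1) * `|x1 - a.1|) d2_gt0).
  by move=> t td; rewrite -mulrA; exact: bound (x1, t) x1d td.
- move=> x2 [_ /= x2d].
  apply: (@cvg_dnbhs_linear_bound _ _ _ _ ((`|l| + 1) * `|x2 - a.2|) d1_gt0).
  by move=> t td; rewrite -mulrA [_ * `|t - _|]mulrC; exact: bound (t, x2) td x2d.
Qed.
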